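(* Let $(X,p,d_X)$ and $(Y,q,d_Y)$ be two pointed metric spaces, let $\omega$ be a non-principal ultrafilter on $\mathbb{N}$ and let $\Lambda=(\lambda_i)_{i\in\mathbb{N}}$ be a sequence of positive real numbers tending to infinity. If $(X,p)$ and $(Y,q)$ are quasi-isometric (as metric germs), then the blow-ups $X_{\omega,\Lambda,p}$ and $Y_{\omega,\Lambda,q}$ are bi-Lipschitz homeomorphic.
   Context: A horn function at $0$ is the germ at $0$ of a non-decreasing function $\varphi:\mathbb{R}_{\ge0}\to\mathbb{R}_{\ge0}$ with $\lim_{t\to0}\varphi(t)/t=0$. Local quasi-isometry: let $(X,p,d_X)$ and $(Y,q,d_Y)$ be metric germs. A map $f:(X,p)\to(Y,q)$ is a germ at $p$ of a map from a neighbourhood of $p$ in $X$ to $Y$, with $f(p)=q$ and $f(x)\to q$ as $x\to p$ (it need not be continuous away from $p$, nor injective). Let $\varphi$ be a horn function at $0$. The map $f$ is a $\varphi$-quasi-isometric embedding if there are constants $L\ge1$, $L_1,L_2>0$ and a neighbourhood $U$ of $p$ in $X$ such that for all $x,x'\in U$ $$\tfrac1L d_X(x,x')-\delta(x,x')\le d_Y(f(x),f(x'))\le L\,d_X(x,x')+\delta(x,x'),\qquad \delta(x,x')=L_1\varphi\big(L_2(d_X(x,p)+d_X(x',p))\big).$$ It is a $\varphi$-quasi-isometry if moreover there are a neighbourhood $V$ of $q$ in $Y$ and constants $L_1',L_2'>0$ such that for every $y\in V$ there is $x\in U$ with $d_Y(y,f(x))\le L_1'\varphi(L_2'd_X(x,p))$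 (since $f$ and $\varphi$ are germs, this is understood for all sufficiently small $U$, with $V$ depending on $U$). $(X,p)$ and $(Y,q)$ are quasi-isometric if there is a $\varphi$-quasi-isometry $(X,p)\to(Y,q)$ for some horn function $\varphi$ at $0$. Ultralimits: for $f:\mathbb{N}\to Z$ with $Z$ a metric space, $\lim_\omega f(i)=z$ means $f^{-1}(W)\in\omega$ for every neighbourhood $W$ of $z$; it exists and is unique for bounded real sequences. The ultralimit $\lim_\omega(X_i,d_i,p_i)$ of pointed metric spaces is the set of sequences $(x_i)$, $x_i\in X_i$, with $\sup_i d_i(x_i,p_i)<\infty$, modulo the relation $d_\omega=0$, where $d_\omega((x_i),(x_i'))=\lim_\omega d_i(x_i,x_i')$, endowed with the metric induced by $d_\omega$. The blow-up of $X$ at $p$ with scale $\Lambda$ is $X_{\omega,\Lambda,p}=\lim_\omega(X,\lambda_i d_X,p)$; $Y_{\omega,\Lambda,q}$ is defined likewise. *)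

(* Defs.v *)
From HB Require Import structures.
From mathcomp Require Import all_boot all_order all_algebra.
From mathcomp Require Import generic_quotient.
From mathcomp Require Import boolp classical_sets functions set_interval reals.
From mathcomp Require Import interval_inference topology normedtype.

Set Implicit Arguments.
Unset Strict Implicit.
Unset Printing Implicit Defensive.

Import Order.TTheory GRing.Theory Num.Theory.
Import numFieldTopology.Exports numFieldNormedType.Exports.

Local Open Scope quotient_scope.
Local Open Scope classical_set_scope.
Local Open Scope ring_scope.

(* A horn function is represented by a function R -> R of which only the
   values on nonnegative arguments matter. *)
Definition horn_function (R : realType) (phi : R -> R) : Prop :=
  [/\ forall t, 0 <= t -> 0 <= phi t,
      forall s t, 0 <= s -> s <= t -> phi s <= phi t
    & phi t / t @[t --> 0^'+] --> 0].

(* The germ at p of a map defined near p is represented by a map on the whole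
   of X, which always exists as Y is inhabited by q. *)
Definition germ_map (R : realType) (X Y : metricType R) (p : X) (q : Y)
    (f : X -> Y) : Prop :=
  f p = q /\ f x @[x --> p] --> q.

Definition qi_embedding (R : realType) (X Y : metricType R) (p : X)
    (phi : R -> R) (f : X -> Y) : Prop :=
  exists L L1 L2 : R, [/\ 1 <= L, 0 < L1, 0 < L2 &
    exists2 U : set X, nbhs p U &
      forall x x', U x -> U x' ->
        let delta := L1 * phi (L2 * (mdist x p + mdist x' p)) in
        L^-1 * mdist x x' - delta <= mdist (f x) (f x')
          <= L * mdist x x' + delta].

(* The constants L1', L2' do not depend on the neighbourhood U of p, which may
   be taken arbitrarily small; only V depends on U. *)
Definition quasi_onto (R : realType) (X Y : metricType R) (p : X) (q : Y)
    (phi : R -> R) (f : X -> Y) : Prop :=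
  exists L1' L2' : R, [/\ 0 < L1', 0 < L2' &
    exists2 U0 : set X, nbhs p U0 &
      forall U : set X, nbhs p U -> U `<=` U0 ->
        exists2 V : set Y, nbhs q V &
          forall y, V y ->
            exists2 x, U x & mdist y (f x) <= L1' * phi (L2' * mdist x p)].

Definition quasi_isometry (R : realType) (X Y : metricType R) (p : X) (q : Y)
    (phi : R -> R) (f : X -> Y) : Prop :=
  [/\ germ_map p q f, qi_embedding p phi f & quasi_onto p q phi f].

Definition quasi_isometric (R : realType) (X Y : metricType R) (p : X) (q : Y)
    : Prop :=
  exists2 phi : R -> R, horn_function phi &
    exists f : X -> Y, quasi_isometry p q phi f.

Definition bilipschitz (R : realType) (A B : metricType R) (f : A -> B)
    : Prop :=
  exists2 L : R, 1 <= L &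
    forall x y, L^-1 * mdist x y <= mdist (f x) (f y) <= L * mdist x y.

Definition homeomorphism (A B : topologicalType) (f : A -> B) : Prop :=
  continuous f /\ exists g : B -> A, [/\ cancel f g, cancel g f & continuous g].

Definition bilipschitz_homeomorphic (R : realType) (A B : metricType R)
    : Prop :=
  exists f : A -> B, homeomorphism f /\ bilipschitz f.

Definition rescale (R : realType) (l : {posnum R}) (X : metricType R) : Type :=
  X.

Section Rescale.
Context {R : realType} (l : {posnum R}) (X : metricType R).

Definition rescale_dist (x y : rescale l X) : R :=
  l%:num * @mdist R X x y.

Lemma rescale_distxx x : rescale_dist x x = 0.
Proof. by rewrite /rescale_dist mdistxx mulr0. Qed.

Lemma rescale_dist_positivity x y : rescale_dist x y = 0 -> x = y.
Proof.
move/eqP; rewrite /rescale_dist mulf_eq0 gt_eqF//= => /eqP.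
exact: mdist_positivity.
Qed.

Lemma rescale_dist_sym x y : rescale_dist x y = rescale_dist y x.
Proof. by rewrite /rescale_dist metric_sym. Qed.

Lemma rescale_dist_triangle y x z :
  rescale_dist x z <= rescale_dist x y + rescale_dist y z.
Proof. by rewrite /rescale_dist -mulrDr ler_pM2l// metric_triangle. Qed.

HB.instance Definition _ := Choice.copy (rescale l X) X.
HB.instance Definition _ := @isMetric.Build R (rescale l X) rescale_dist
  rescale_distxx rescale_dist_positivity rescale_dist_sym
  rescale_dist_triangle.

Lemma mdist_rescale (x y : rescale l X) :
  mdist x y = l%:num * @mdist R X x y.
Proof. by []. Qed.

End Rescale.

Definition nonprincipal (T : Type) (F : set_system T) : Prop :=
  forall x : T, F <> principal_filter x.

Lemma ultra_bounded_cvg (R : realType) (w : set_system nat)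
    (w_ultra : UltraFilter w) (u : nat -> R) (C : R) :
  (forall i, `|u i| <= C) -> cvg (u @ w).
Proof.
move=> uC.
have uw : (u @ w) [set` `[- C, C]].
  by apply: (@filterE _ w) => i; rewrite /= in_itv/= -ler_norml.
have [z [_ uz]] := @segment_compact R (- C) C (u @ w) _ uw.
apply/cvg_ex; exists z => W zW.
have [//|wW] := in_ultra_setVsetC (u @^-1` W) w_ultra.
by have [t []] := uz (~` W) W wW zW.
Qed.

Section Ultralimit.
Context {R : realType} (w : set_system nat) {w_ultra : UltraFilter w}.
Context (X : nat -> metricType R) (p : forall i, X i).

Record bdd_seq := BddSeq {
  bdd_seq_val :> forall i, X i ;
  bdd_seqP : has_ubound (range (fun i => mdist (bdd_seq_val i) (p i)))
}.

HB.instance Definition _ := gen_eqMixin bdd_seq.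
HB.instance Definition _ := gen_choiceMixin bdd_seq.

Definition ultra_dist (x y : bdd_seq) : R :=
  lim ((fun i => mdist (x i) (y i)) @ w).

Lemma ultra_dist_cvg (x y : bdd_seq) :
  (fun i => mdist (x i) (y i)) @ w --> ultra_dist x y.
Proof.
have [[C xC] [D yD]] := (bdd_seqP x, bdd_seqP y).
apply: (@ultra_bounded_cvg _ _ _ _ (C + D)) => i.
rewrite ger0_norm ?mdist_ge0// (le_trans (metric_triangle _ (p i) _))//.
by rewrite (metric_sym (p i)) lerD//; [apply: xC|apply: yD]; exists i.
Qed.

Arguments ultra_dist_cvg : clear implicits.

Lemma ultra_distxx x : ultra_dist x x = 0.
Proof.
rewrite /ultra_dist (_ : (fun _ => _) = fun=> 0) ?lim_cst//.
by apply/funext => i; rewrite mdistxx.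
Qed.

Lemma ultra_dist_sym x y : ultra_dist x y = ultra_dist y x.
Proof.
by congr (lim (_ @ w)); apply/funext => i; rewrite metric_sym.
Qed.

Lemma ultra_dist_ge0 x y : 0 <= ultra_dist x y.
Proof.
apply: (cvgr_to_ge (ultra_dist_cvg x y)).
by apply: filterE => i; rewrite mdist_ge0.
Qed.

Lemma ultra_dist_triangle y x z :
  ultra_dist x z <= ultra_dist x y + ultra_dist y z.
Proof.
have xyz := cvgD (ultra_dist_cvg x y) (ultra_dist_cvg y z).
apply: (ler_cvg_to (ultra_dist_cvg x z) (xyz _)).
by apply: filterE => i; exact: metric_triangle.
Qed.

Definition ultra_eq (x y : bdd_seq) : bool := ultra_dist x y == 0.

Lemma ultra_eq_refl : reflexive ultra_eq.
Proof. by move=> x; rewrite /ultra_eq ultra_distxx. Qed.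

Lemma ultra_eq_sym : symmetric ultra_eq.
Proof. by move=> x y; rewrite /ultra_eq ultra_dist_sym. Qed.

Lemma ultra_eq_trans : transitive ultra_eq.
Proof.
move=> y x z /eqP xy /eqP yz; rewrite /ultra_eq eq_le ultra_dist_ge0 andbT.
by rewrite (le_trans (ultra_dist_triangle y _ _))// xy yz addr0.
Qed.

Canonical ultra_equiv :=
  EquivRel ultra_eq ultra_eq_refl ultra_eq_sym ultra_eq_trans.

Definition ultralimit : Type := {eq_quot ultra_eq}.

HB.instance Definition _ := EqQuotient.on ultralimit.
HB.instance Definition _ := Choice.on ultralimit.

(* The metric induced on classes, computed on chosen representatives;
   ultra_mdist_pi shows that the choice is immaterial. *)
Definition ultra_mdist (a b : ultralimit) : R := ultra_dist (repr a) (repr b).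

Lemma ultra_mdist_pi (x y : bdd_seq) :
  ultra_mdist (\pi_ultralimit x) (\pi_ultralimit y) = ultra_dist x y.
Proof.
have H z : ultra_dist (repr (\pi_ultralimit z)) z = 0.
  apply/eqP; rewrite -[_ == 0]/(ultra_eq _ _).
  by apply/(eqmodP ultra_equiv); rewrite reprK.
have := (H x, H y); rewrite /ultra_mdist.
set x' := repr (\pi_ultralimit x); set y' := repr (\pi_ultralimit y).
move=> [xx yy].
apply/eqP; rewrite eq_le; apply/andP; split.
  rewrite (le_trans (ultra_dist_triangle x _ _))// xx add0r.
  by rewrite (le_trans (ultra_dist_triangle y _ _))// (ultra_dist_sym y) yy addr0.
rewrite (le_trans (ultra_dist_triangle x' _ _))// (ultra_dist_sym x) xx add0r.
by rewrite (le_trans (ultra_dist_triangle y' _ _))// yy addr0.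
Qed.

Lemma ultra_mdistxx a : ultra_mdist a a = 0.
Proof. exact: ultra_distxx. Qed.

Lemma ultra_mdist_positivity a b : ultra_mdist a b = 0 -> a = b.
Proof.
move=> /eqP ab; rewrite -[a]reprK -[b]reprK.
exact/(eqmodP ultra_equiv).
Qed.

Lemma ultra_mdist_sym a b : ultra_mdist a b = ultra_mdist b a.
Proof. exact: ultra_dist_sym. Qed.

Lemma ultra_mdist_triangle b a c :
  ultra_mdist a c <= ultra_mdist a b + ultra_mdist b c.
Proof. exact: ultra_dist_triangle. Qed.

HB.instance Definition _ := @isMetric.Build R ultralimit ultra_mdist
  ultra_mdistxx ultra_mdist_positivity ultra_mdist_sym ultra_mdist_triangle.

Lemma mdist_ultralimit (x y : bdd_seq) :
  mdist (\pi_ultralimit x) (\pi_ultralimit y)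
    = lim ((fun i => mdist (x i) (y i)) @ w).
Proof. exact: ultra_mdist_pi. Qed.

End Ultralimit.

Arguments ultra_dist_cvg {R w w_ultra X p} x y.
Arguments ultralimit {R} w {w_ultra} X p.

Definition blow_up (R : realType) (w : set_system nat)
    (w_ultra : UltraFilter w) (lambda : nat -> {posnum R})
    (X : metricType R) (p : X) : metricType R :=
  ultralimit w (fun i => rescale (lambda i) X) (fun=> p).

(* Main.v *)
(** A quasi-isometry [f] acts on scaled sequences by [x_i |-> f (x_i)].  As
    [phi] is sublinear at [0] and the points [x_i] lie within [C / lambda_i] of
    [p], the error terms multiplied by [lambda_i] tend to [0], so the induced
    map of the blow-ups is bi-Lipschitz with the multiplicative constant of
    [f].  It is onto because near [p] the errors are absorbed by half of
    [d(x, p)], whence approximate preimages [x_i] of a scaled sequence [y_i]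
    satisfy [d(x_i, p) <= 2 L d(y_i, q)] and again form a scaled sequence. *)

Require Import Defs.
From mathcomp Require Import all_boot all_order all_algebra.
From mathcomp Require Import boolp classical_sets functions set_interval reals.
From mathcomp Require Import interval_inference topology normedtype.
From mathcomp Require Import generic_quotient ring lra.
Import numFieldTopology.Exports numFieldNormedType.Exports.
Import Order.TTheory GRing.Theory Num.Theory.
Import metricType_numDomainType.
Local Open Scope classical_set_scope.
Local Open Scope ring_scope.

(** * Lipschitz and bi-Lipschitz maps *)

Lemma lipschitz_continuous {R : realType} {A B : metricType R} {f : A -> B}
    {L : R} :
  0 < L -> (forall x y, mdist (f x) (f y) <= L * mdist x y) -> continuous f.
Proof.
move=> L0 fL x; apply/cvgrPdist_lt => e e0.
have Le0 : 0 < L^-1 * e by rewrite mulr_gt0 ?invr_gt0.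
apply/nbhs_mdistP; exists (L^-1 * e) => //= y xy.
by apply: le_lt_trans (fL _ _) _; rewrite -ltr_pdivlMl.
Qed.

(** The lower bound makes any section of [f] Lipschitz with the same constant and forces
    injectivity, so a chosen right inverse is a continuous two-sided inverse. *)
Lemma bilipschitz_surj {R : realType} {A B : metricType R} {f : A -> B} :
  bilipschitz f -> (forall b, exists a, f a = b) ->
  bilipschitz_homeomorphic A B.
Proof.
move=> fbl /choice[g fgK]; exists f; split => //.
have [L L1 fL] := fbl; have L0 : 0 < L by apply: lt_le_trans L1.
split; first by apply: lipschitz_continuous L0 _ => x y; case/andP: (fL x y).
have gL x y : mdist (g x) (g y) <= L * mdist x y.
  have /andP[+ _] := fL (g x) (g y).
  by rewrite !fgK ler_pdivrMl.
exists g; split => // [x|]; last exact: lipschitz_continuous L0 gL.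
apply/mdist_positivity/eqP; rewrite eq_le mdist_ge0 andbT.
have /andP[+ _] := fL (g (f x)) x.
by rewrite fgK mdistxx pmulr_rle0 // invr_gt0.
Qed.

(** An ultrafilter containing a singleton is principal there, so [w] contains the complement of each
    [[set n]]; removing these one by one leaves the tails. *)
Lemma ultra_nonprincipal_eventually {w : set_system nat} :
  UltraFilter w -> nonprincipal w -> \oo `<=` w.
Proof.
move=> w_ultra w_np A [N _ NA].
suff wN n : w [set i | (n <= i)%N] by apply: filterS (wN N) => i; exact: NA.
elim: n => [|n IHn]; first exact: filterE.
have [wn|wn] := in_ultra_setVsetC [set n] w_ultra.
  case: (w_np n); apply/seteqP; split => B /= wB.
    have [i [/= Bi ni]] := filter_ex (filterI wB wn).
    by move=> j /= ->; rewrite -ni.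
  by apply: filterS wn => i ->; exact: wB.
apply: filterS2 IHn wn => i /= ni /eqP ine.
by rewrite ltn_neqAle eq_sym ni andbT.
Qed.

Lemma horn_function_littleo {R : realType} {phi : R -> R} {e : R} :
  horn_function phi -> 0 < e ->
  exists2 r, 0 < r & forall t, 0 <= t -> t < r -> phi t <= e * t.
Proof.
move=> [phi0 phile phil] e0.
have /cvgr0Pnorm_lt/(_ e e0) := phil.
rewrite /at_right /= => -[r /= r0 rP]; exists r => // t.
have pos s : 0 < s -> s < r -> phi s <= e * s.
  move=> s0 sr; have := rP s; rewrite /= sub0r normrN gtr0_norm// => /(_ sr s0).
  rewrite normrM normfV (gtr0_norm s0) ltr_pdivrMr// => /ltW.
  exact/le_trans/ler_norm.
rewrite le_eqVlt => /orP[/eqP <- _|]; last exact: pos.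
(* The limit at [0^'+] says nothing about [phi 0]; monotonicity bounds it by [phi s <= e * s <= d]
   for a small [s > 0]. *)
rewrite mulr0; apply/ler_addgt0Pr => d d0; rewrite add0r.
pose s := Num.min (r / 2) (d / e).
have s0 : 0 < s by rewrite lt_min !divr_gt0.
have sr : s < r by rewrite gt_min ltr_pdivrMr// ltr_pMr// ltr1n.
apply: le_trans (phile 0 s _ (ltW s0)) _ => //; apply: le_trans (pos _ s0 sr) _.
by rewrite mulrC -ler_pdivlMr// ge_min lexx orbT.
Qed.

(** Since [u i <= C / lambda i] tends to 0, sublinearity bounds [phi (K * u i)] by a small multiple
    of [K * u i], and [lambda i * u i] stays bounded. *)
Lemma horn_function_scale_cvg {R : realType} {phi : R -> R}
    {w : set_system nat} {lambda u : nat -> R} {K : R} (C : R) :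
  Filter w -> horn_function phi -> lambda i @[i --> w] --> +oo -> 0 < K ->
  (forall i, 0 <= u i) -> (forall i, lambda i * u i <= C) ->
  lambda i * phi (K * u i) @[i --> w] --> 0.
Proof.
move=> Fw hphi lambda_infty K0 u0 uC; apply/cvgr0Pnorm_le => e e0.
(* [M] bounds [lambda i * (K * u i)]; adding 1 keeps it positive, so that [e / M] makes sense as a
   slope. *)
pose M := K * (`|C| + 1).
have M0 : 0 < M by rewrite mulr_gt0// ltr_wpDl.
have [r r0 rP] := horn_function_littleo hphi (divr_gt0 e0 M0).
have /cvgryPgt/(_ (M / r)) := lambda_infty.
apply: filterS => i Mi.
have l0 : 0 < lambda i by apply: le_lt_trans Mi; rewrite divr_ge0 ?ltW.
have Ku0 : 0 <= K * u i by rewrite mulr_ge0// ltW.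
have KuM : lambda i * (K * u i) <= M.
  rewrite mulrCA ler_pM2l//; apply: le_trans (uC i) _.
  by apply: le_trans (ler_norm _) _; rewrite lerDl.
have Kur : K * u i < r.
  rewrite -(ltr_pM2l l0); apply: le_lt_trans KuM _.
  by rewrite -ltr_pdivrMr.
have [phi0 _ _] := hphi.
rewrite ger0_norm ?mulr_ge0 ?phi0 ?(ltW l0)//.
apply: (@le_trans _ _ (lambda i * (e / M * (K * u i)))).
  by rewrite ler_pM2l//; exact: rP.
by rewrite mulrCA mulrAC ler_pdivrMr// ler_pM2l.
Qed.

(** * Scaled sequences and the action of a quasi-isometry on them *)

Section ScaledSequences.
Context {R : realType} {w : set_system nat} {w_ultra : UltraFilter w}.
Context (lambda : nat -> {posnum R}).
Hypothesis lambda_infty : (lambda i)%:num @[i --> w] --> +oo.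

Local Notation scaled_seq p :=
  (bdd_seq (X := fun i => rescale (lambda i) _) (fun=> p)).

Lemma scaled_seq_bound {X : metricType R} {p : X} (x : scaled_seq p) :
  exists C, forall i, (lambda i)%:num * mdist (x i : X) p <= C.
Proof. by have [C xC] := bdd_seqP x; exists C => i; apply: xC; exists i. Qed.

Lemma scaled_seq_nbhs {X : metricType R} {p : X} (x : scaled_seq p)
    {U : set X} :
  nbhs p U -> \forall i \near w, U (x i).
Proof.
rewrite -filter_from_mdist_nbhs => -[e /= e0 eU].
have [C xC] := scaled_seq_bound x.
have /cvgryPgt/(_ (C / e)) := lambda_infty.
apply: filterS => i Ci; apply: eU => /=.
rewrite metric_sym -(ltr_pM2l (gt0 (lambda i))); apply: le_lt_trans (xC i) _.
by rewrite -ltr_pdivrMr.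
Qed.

(** A [bdd_seq] is bounded at every index, whereas estimates hold only along [w]. Resetting the
    offending entries to [p] repairs this without changing the sequence on a set of [w]. *)
Lemma scaled_seq_near {X : metricType R} {p : X} {z : nat -> X} {C : R} :
  (\forall i \near w, (lambda i)%:num * mdist (z i) p <= C) ->
  exists x : scaled_seq p, \forall i \near w, x i = z i.
Proof.
move=> zC; pose x i : rescale (lambda i) X :=
  if (lambda i)%:num * mdist (z i) p <= C then z i else p.
have xP : has_ubound (range (fun i => mdist (x i) (p : rescale (lambda i) X))).
  exists `|C| => _ [i _ <-]; rewrite mdist_rescale /x.
  case: ifPn => [zi|_]; first exact: le_trans (ler_norm _).
  by rewrite mdistxx mulr0.
by exists (BddSeq xP); apply: filterS zC => i /= zi; rewrite /x zi.
Qed.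

Context {X Y : metricType R} {p : X} {q : Y} {phi : R -> R} {f : X -> Y}.
Hypothesis hphi : horn_function phi.

Definition qi_bounds (L L1 L2 : R) (U : set X) :=
  forall x x', U x -> U x' ->
    L^-1 * mdist x x' - L1 * phi (L2 * (mdist x p + mdist x' p))
      <= mdist (f x) (f x')
      <= L * mdist x x' + L1 * phi (L2 * (mdist x p + mdist x' p)).

Context {L L1 L2 : R} {U : set X}.
Hypotheses (L_ge1 : 1 <= L) (L1_gt0 : 0 < L1) (L2_gt0 : 0 < L2) (pU : nbhs p U).
Hypothesis fU : qi_bounds L L1 L2 U.

Lemma scaled_error_cvg (x x' : scaled_seq p) :
  (lambda i)%:num * (L1 * phi (L2 * (mdist (x i : X) p + mdist (x' i : X) p)))
    @[i --> w] --> 0.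
Proof.
have [[C xC] [C' xC']] := (scaled_seq_bound x, scaled_seq_bound x').
rewrite -(mulr0 L1); under eq_fun do rewrite mulrCA.
apply: cvgMl_tmp; apply: (horn_function_scale_cvg (C + C')) => // i.
  by rewrite addr_ge0// mdist_ge0.
by rewrite mulrDr lerD.
Qed.

(** After scaling, the error vanishes in the limit along [w], so only the multiplicative bounds
    survive. In particular, equivalent sequences have equivalent images. *)
Lemma qi_ultra_dist {x x' : scaled_seq p} {y y' : scaled_seq q} :
  (\forall i \near w, y i = f (x i)) -> (\forall i \near w, y' i = f (x' i)) ->
  L^-1 * ultra_dist w x x' <= ultra_dist w y y' <= L * ultra_dist w x x'.
Proof.
move=> yx yx'.
have xx := @ultra_dist_cvg _ _ w_ultra _ _ x x'.
have yy := @ultra_dist_cvg _ _ w_ultra _ _ y y'.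
have er := scaled_error_cvg x x'.
have xU := scaled_seq_nbhs x pU; have xU' := scaled_seq_nbhs x' pU.
apply/andP; split.
- rewrite -[leLHS]subr0.
  have lo := cvgB (cvgMl_tmp (a := L^-1) xx) er.
  apply: (ler_cvg_to (lo _ _) yy).
  near=> i; rewrite !fctE !mdist_rescale (near yx i)// (near yx' i)//.
  rewrite mulrCA -mulrBr ler_pM2l//.
  have xUi : U (x i) by near: i.
  have xUi' : U (x' i) by near: i.
  by have /andP[] := fU _ _ xUi xUi'.
- rewrite -[leRHS]addr0.
  have up := cvgD (cvgMl_tmp (a := L) xx) er.
  apply: (ler_cvg_to yy (up _ _)).
  near=> i; rewrite !fctE !mdist_rescale (near yx i)// (near yx' i)//.
  rewrite mulrCA -mulrDr ler_pM2l//.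
  have xUi : U (x i) by near: i.
  have xUi' : U (x' i) by near: i.
  by have /andP[] := fU _ _ xUi xUi'.
Unshelve. all: by end_near. Qed.

Hypothesis fp : f p = q.

(** Comparison with the constant sequence [p], sent to [q], bounds the scaled distance from
    [f (x i)] to [q] by [L * C] plus an error that is eventually at most 1. *)
Lemma qi_scaled_seq (x : scaled_seq p) :
  exists y : scaled_seq q, \forall i \near w, y i = f (x i).
Proof.
have [C xC] := scaled_seq_bound x.
have pP : has_ubound
    (range (fun i => mdist (p : rescale (lambda i) X) (p : rescale _ X))).
  by exists 0 => _ [i _ <-]; rewrite mdistxx.
have /cvgr0Pnorm_le/(_ 1 ltr01) er := scaled_error_cvg x (BddSeq pP).
have xU := scaled_seq_nbhs x pU.
apply: (scaled_seq_near (C := L * C + 1)).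
apply: filterS2 er xU => i eri xUi.
have /andP[_ +] := fU _ _ xUi (nbhs_singleton pU).
rewrite fp -(ler_pM2l (gt0 (lambda i))) => /le_trans; apply.
rewrite mulrDr lerD ?(le_trans (ler_norm _) eri)//.
by rewrite mulrCA ler_pM2l// (lt_le_trans ltr01 L_ge1).
Qed.

(** As [f (x i)] may be unbounded off a set of [w], the image of [x] is represented by any [y']
    agreeing with it along [w]. *)
Lemma qi_ultra_surj (y : scaled_seq q) : quasi_onto p q phi f ->
  exists x : scaled_seq p, forall y' : scaled_seq q,
    (\forall i \near w, y' i = f (x i)) -> ultra_dist w y y' = 0.
Proof.
move=> [L1' [L2' [L1'_gt0 L2'_gt0 [U0 pU0 onto]]]].
have L_gt0 : 0 < L by apply: lt_le_trans L_ge1.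
(* Two errors, from the lower embedding bound and from [onto], each multiplied by [L], will take a
   quarter of the distance to [p]; the remaining half gives the factor [2 * L]. *)
have absorb M K : 0 < M -> 0 < K -> exists2 r, 0 < r &
    forall t, 0 <= t -> t < r -> L * (M * phi (K * t)) <= t / 4.
  move=> M0 K0; have LMK0 : 0 < 4 * (L * M * K) by rewrite !mulr_gt0.
  have iLMK0 : 0 < (4 * (L * M * K))^-1 by rewrite invr_gt0.
  have [r r0 rP] := horn_function_littleo hphi iLMK0.
  exists (r / K) => [|t t0 tr]; first by rewrite divr_gt0.
  have Kt0 : 0 <= K * t by rewrite mulr_ge0// ltW.
  have Ktr : K * t < r by rewrite mulrC -ltr_pdivlMr.
  have := ler_wpM2l (ltW (mulr_gt0 L_gt0 M0)) (rP _ Kt0 Ktr).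
  rewrite -mulrA => /le_trans; apply; rewrite le_eqVlt; apply/orP; left.
  by apply/eqP; field; rewrite !gt_eqF.
have [r1 r1_gt0 r1P] := absorb _ _ L1_gt0 L2_gt0.
have [r2 r2_gt0 r2P] := absorb _ _ L1'_gt0 L2'_gt0.
(* Applying [onto] inside [W] keeps the preimages where the embedding bound and both absorptions
   hold. *)
pose W := U `&` U0 `&` [set x | mdist p x < Num.min r1 r2].
have pW : nbhs p W.
  apply: filterI; first exact: filterI.
  by apply/nbhs_mdistP; exists (Num.min r1 r2); rewrite //= lt_min r1_gt0.
have WU0 : W `<=` U0 by move=> x [[]].
have [V qV VW] := onto _ pW WU0.
have /choice[z zP] : forall i, exists x : X, V (y i) ->
    W x /\ mdist (y i : Y) (f x) <= L1' * phi (L2' * mdist x p).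
  (* The default [p] is harmless, as [V (y i)] holds along [w]. *)
  move=> i; have [yV|nyV] := pselect (V (y i)); last by exists p.
  by have [x Wx yx] := VW _ yV; exists x.
have yV := scaled_seq_nbhs y qV.
have [C yC] := scaled_seq_bound y.
have zC : \forall i \near w, (lambda i)%:num * mdist (z i) p <= 2 * L * C.
  apply: filterS yV => i /zP[[[zU zU0]]] /=.
  rewrite lt_min metric_sym => /andP[zr1 zr2] yfz.
  have z0 := mdist_ge0 (z i) p.
  have := r1P _ z0 zr1; have := r2P _ z0 zr2.
  have /andP[+ _] := fU _ _ zU (nbhs_singleton pU).
  rewrite fp mdistxx addr0 lerBlDr ler_pdivrMl// => zq e2 e1.
  have fzq : L * mdist (f (z i)) q <=
      L * (L1' * phi (L2' * mdist (z i) p)) + L * mdist (y i : Y) q.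
    rewrite -mulrDr ler_pM2l// (le_trans (metric_triangle _ (y i : Y) _))//.
    by rewrite lerD2r metric_sym.
  have zyq : mdist (z i) p <= 2 * L * mdist (y i : Y) q.
    by rewrite mulrDr in zq; lra.
  rewrite -(ler_pM2l (gt0 (lambda i))) in zyq; apply: le_trans zyq _.
  by rewrite mulrCA ler_pM2l// mulr_gt0.
have [x xz] := scaled_seq_near zC.
exists x => y' y'x; apply/eqP; rewrite eq_le ultra_dist_ge0 andbT.
have [D xD] := scaled_seq_bound x.
(* Once [x] is a scaled sequence, the error in [onto], which bounds the distance from [y i] to
   [f (x i)], also vanishes after scaling. *)
have er : (lambda i)%:num * (L1' * phi (L2' * mdist (x i : X) p)) @[i --> w]
    --> 0.
  rewrite -(mulr0 L1'); under eq_fun do rewrite mulrCA.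
  apply: cvgMl_tmp; apply: (horn_function_scale_cvg D) => // i.
  exact: mdist_ge0.
apply: (ler_cvg_to (ultra_dist_cvg y y') er).
near=> i; rewrite mdist_rescale ler_pM2l// (near y'x i)// (near xz i)//.
have Vyi : V (y i) by near: i.
by have [] := zP i Vyi.
Unshelve. all: by end_near. Qed.

End ScaledSequences.

(** * The induced map of the blow-ups *)

Theorem theorem3p1 (R : realType) (X Y : metricType R) (p : X) (q : Y)
    (w : set_system nat) (w_ultra : UltraFilter w) (w_np : nonprincipal w)
    (lambda : nat -> {posnum R})
    (lambda_infty : (lambda i)%:num @[i --> \oo] --> +oo) :
  quasi_isometric p q ->
  bilipschitz_homeomorphic (blow_up w_ultra lambda p)
                           (blow_up w_ultra lambda q).
Proof.
move=> [phi hphi [f [[fp _] [L [L1 [L2 []]]]]]].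
move=> L_ge1 L1_gt0 L2_gt0 [U pU fU] onto.
have lambda_w : (lambda i)%:num @[i --> w] --> +oo.
  apply: cvg_trans lambda_infty; apply: cvg_app.
  exact: ultra_nonprincipal_eventually.
have [g gP] := choice
  (qi_scaled_seq lambda lambda_w hphi L_ge1 L2_gt0 pU fU fp).
have gL x x' : L^-1 * ultra_dist w x x' <= ultra_dist w (g x) (g x')
    <= L * ultra_dist w x x'.
  exact: (qi_ultra_dist lambda lambda_w hphi L2_gt0 pU fU (gP x) (gP x')).
pose F (a : blow_up w_ultra lambda p) : blow_up w_ultra lambda q :=
  \pi%qT (g (repr a)).
have FE a b : mdist (F a) (F b) = ultra_dist w (g (repr a)) (g (repr b)).
  exact: ultra_mdist_pi.
apply: (bilipschitz_surj (f := F)).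
  exists L => // a b; rewrite FE; exact: gL.
move=> b; have [x xb] := qi_ultra_surj lambda lambda_w hphi L_ge1 L1_gt0 L2_gt0
  pU fU fp (repr b) onto.
pose a : blow_up w_ultra lambda p := \pi%qT x.
(* [repr a] need not be [x], only equivalent to it; [gL] then allows [g (repr a)] to be replaced by
   [g x], which [xb] compares with [repr b]. *)
have ax : ultra_dist w (repr a) x = 0.
  by rewrite -ultra_mdist_pi reprK; exact: ultra_mdistxx.
have gax : ultra_dist w (g (repr a)) (g x) <= 0.
  by have /andP[_] := gL (repr a) x; rewrite ax mulr0.
exists a; apply: ultra_mdist_positivity; rewrite -[b]reprK ultra_mdist_pi.
apply/eqP; rewrite eq_le ultra_dist_ge0 andbT.
apply: le_trans (ultra_dist_triangle (g x) _ _) _.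
by rewrite (ultra_dist_sym _ (g x)) (xb _ (gP x)) addr0.
Qed.
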